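(* Let $f=\frac1n\sum_{i=1}^n f_i$ where each $f_i:\mathbb{R}^d\to\mathbb{R}$ is convex and $L_i$-smooth, assume that $f$ is $\mu$-strongly convex ($\mu>0$) with minimizer $x^*$, and let $L_{\max}=\max_{1\le i\le n}L_i$. Assume interpolation, i.e. $\sigma=0$. Then the iterates of SGD with SPS with $c=1/2$ satisfy, for all $k\ge0$, $$\mathbb{E}\|x^{k}-x^*\|^2\le\left(1-\frac{\mu}{L_{\max}}\right)^k\|x^0-x^*\|^2.$$
   Context: Setting: $f(x)=\frac1n\sum_{i=1}^n f_i(x)$ is minimized over $\mathbb{R}^d$, and the set $\mathcal{X}^*$ of minimizers of $f$ is nonempty. A function is $L$-smooth if it is differentiable with $L$-Lipschitz gradient. For each $i$, $f_i^*:=\inf_x f_i(x)$, and it is assumed throughout that $\sigma^2:=\mathbb{E}_i[f_i(x^* )-f_i^*]=f(x^* )-\frac1n\sum_{i=1}^n f_i^*<\infty$ (so all $f_i^*$ are finite), where $x^*\in\mathcal{X}^*$. SGD: starting from a deterministic $x^0$, at each iteration $k$ an index $i\in\{1,\dots,n\}$ is drawn uniformly at random, independently of the past, and $x^{k+1}=x^k-\gamma_k\nabla f_i(x^k)$. SPS with parameter $c>0$: $\gamma_k=\frac{f_i(x^k)-f_i^*}{c\|\nabla f_i(x^k)\|^2}$, where $i$ is the index drawn at iteration $k$ (no upper bound is imposed on the step-size). If $\nabla f_i(x^k)=0$ then $x^{k+1}=x^k$. *)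

(* Defs.v *)
From HB Require Import structures.
From mathcomp Require Import all_boot all_order all_algebra.
From mathcomp Require Import all_classical all_reals all_analysis.

Set Implicit Arguments.
Unset Strict Implicit.
Unset Printing Implicit Defensive.

Import Order.TTheory GRing.Theory Num.Theory.
Import numFieldNormedType.Exports.

Local Open Scope classical_set_scope.
Local Open Scope ring_scope.

(* The library norm `|x| on 'rV[R]_d is the sup norm, hence this definition.
   Both norms induce the same topology, so [differentiable] below has its
   usual meaning. *)
Definition enorm (R : realType) (d : nat) (x : 'rV[R]_d) : R :=
  Num.sqrt (\sum_(j < d) x 0 j ^+ 2).

Definition grad (R : realType) (d : nat) (g : 'rV[R]_d -> R) (x : 'rV[R]_d) :
    'rV[R]_d :=
  \row_(j < d) 'D_(delta_mx 0 j) g x.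

Definition smooth (R : realType) (d : nat) (L : R) (g : 'rV[R]_d -> R) : Prop :=
  (forall x, differentiable g x) /\
  (forall x y, enorm (grad g x - grad g y) <= L * enorm (x - y)).

Definition strongly_convex (R : realType) (d : nat) (mu : R)
    (g : 'rV[R]_d -> R) : Prop :=
  forall (x y : 'rV[R]_d) (t : R), 0 <= t <= 1 ->
    g (t *: x + (1 - t) *: y) <=
      t * g x + (1 - t) * g y - mu / 2 * (t * (1 - t)) * enorm (x - y) ^+ 2.

Definition finite_avg (R : realType) (d n : nat) (f : 'I_n -> 'rV[R]_d -> R)
    (x : 'rV[R]_d) : R :=
  n%:R^-1 * \sum_(i < n) f i x.

Definition minimizer (R : realType) (d : nat) (g : 'rV[R]_d -> R)
    (xs : 'rV[R]_d) : Prop :=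
  forall x, g xs <= g x.

(* The real [inf] is the true infimum only when the range of g is bounded
   below. *)
Definition inf_value (R : realType) (d : nat) (g : 'rV[R]_d -> R) : R :=
  inf (range g).

Definition sigma2 (R : realType) (d n : nat) (f : 'I_n -> 'rV[R]_d -> R)
    (xs : 'rV[R]_d) : R :=
  n%:R^-1 * \sum_(i < n) (f i xs - inf_value (f i)).

Definition sps_stepsize (R : realType) (d : nat) (c : R) (g : 'rV[R]_d -> R)
    (x : 'rV[R]_d) : R :=
  (g x - inf_value g) / (c * enorm (grad g x) ^+ 2).

Definition sps_step (R : realType) (d : nat) (c : R) (g : 'rV[R]_d -> R)
    (x : 'rV[R]_d) : 'rV[R]_d :=
  if grad g x == 0 then x else x - sps_stepsize c g x *: grad g x.

Fixpoint sgd_sps (R : realType) (d n : nat) (c : R)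
    (f : 'I_n -> 'rV[R]_d -> R) (x0 : 'rV[R]_d) (idx : nat -> 'I_n) (k : nat) :
    'rV[R]_d :=
  if k is k'.+1 then
    sps_step c (f (idx k')) (sgd_sps c f x0 idx k')
  else x0.

Definition iid_uniform (disp : measure_display) (T : measurableType disp)
    (R : realType) (P : probability T R) (n : nat) (I : nat -> T -> 'I_n) :
    Prop :=
  [/\ forall (k : nat) (A : set 'I_n), measurable (I k @^-1` A),
      forall (k : nat) (i : 'I_n), P (I k @^-1` [set i]) = (n%:R^-1)%:E
    & forall (s : seq nat) (A : nat -> set 'I_n), uniq s ->
        P (\bigcap_(k in [set` s]) I k @^-1` A k) =
          (\prod_(k <- s) P (I k @^-1` A k))%E].

(* Main.v *)
Require Import Defs.
From HB Require Import structures.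
From mathcomp Require Import all_boot all_order all_algebra.
From mathcomp Require Import all_classical all_reals all_analysis.
From mathcomp Require Import ring lra measurable_realfun.

Set Implicit Arguments.
Unset Strict Implicit.
Unset Printing Implicit Defensive.

Import Order.TTheory GRing.Theory Num.Theory.
Import numFieldNormedType.Exports.

Local Open Scope classical_set_scope.
Local Open Scope ring_scope.

(** Write D_i(x) = f_i(xs) - f_i(x) - <grad f_i(x), xs - x> for the Bregman
    gap of f_i, which is nonnegative by convexity.  Interpolation means that
    xs minimizes every f_i, so f_i(x) - inf f_i = f_i(x) - f_i(xs).  With
    c = 1/2 the step-size is gamma = 2 (f_i(x) - f_i(xs)) / |grad f_i(x)|^2,
    and expanding the square gives the exact identity
      |x+ - xs|^2 = |x - xs|^2 - 2 gamma D_i(x).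
    Since f_i is Lmax-smooth and bounded below, one gradient step of length
    1/Lmax shows |grad f_i(x)|^2 <= 2 Lmax (f_i(x) - inf f_i), that is,
    gamma >= 1/Lmax; hence |x+ - xs|^2 <= |x - xs|^2 - (2/Lmax) D_i(x)
    ([sps_step_dist]).

    Averaging over i turns the D_i into the Bregman gap of f, which is at least
    (mu/2) |x - xs|^2 by strong convexity; so one step contracts the mean
    squared distance by 1 - mu/Lmax ([avg_sps_step_dist]).  Only strong
    convexity of the average is used, not of the individual f_i.

    The k-th iterate is a function of the first k indices, which are uniformly
    distributed over the words of length k, so the expectation is a finite
    average over words ([expectation_iid_uniform]), and the one-step bound
    iterates along the letters of the word ([sgd_sps_mean_contract]).  This
    iteration needs 1 - mu/Lmax >= 0 and Lmax > 0; both hold when x0 <> xs,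
    and when x0 = xs the iterates never move. *)

(** * Euclidean geometry of row vectors *)

Section Euclid.
Context {R : realType} {d : nat}.
Implicit Types (u v w x y : 'rV[R]_d) (a : R).

(** The Euclidean inner product, whose norm is [enorm]. *)
Definition dot u v : R := \sum_(j < d) u 0 j * v 0 j.

Lemma enorm_sqr x : enorm x ^+ 2 = dot x x.
Proof.
rewrite /enorm sqr_sqrtr; last by apply: sumr_ge0 => j _; exact: sqr_ge0.
by apply: eq_bigr => j _; rewrite expr2.
Qed.

Lemma enorm_ge0 x : 0 <= enorm x.
Proof. exact: sqrtr_ge0. Qed.

Lemma enorm0 : enorm (0 : 'rV[R]_d) = 0.
Proof. by rewrite /enorm big1 ?sqrtr0// => j _; rewrite mxE expr0n. Qed.

Lemma enorm_eq0 x : (enorm x == 0) = (x == 0).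
Proof.
apply/eqP/eqP => [x0|->]; last exact: enorm0.
have : dot x x == 0 by rewrite -enorm_sqr x0 expr0n.
rewrite psumr_eq0 => [/allP/= h|j _]; last by rewrite -expr2 sqr_ge0.
apply/rowP => j; rewrite mxE; apply/eqP.
by have := h j (mem_index_enum j); rewrite -expr2 sqrf_eq0.
Qed.

Lemma enorm_gt0 x : (0 < enorm x) = (x != 0).
Proof. by rewrite lt_neqAle enorm_ge0 andbT eq_sym enorm_eq0. Qed.

Lemma enormC x y : enorm (x - y) = enorm (y - x).
Proof.
by rewrite /enorm; congr Num.sqrt; apply: eq_bigr => j _; rewrite !mxE; ring.
Qed.

Lemma dotC u v : dot u v = dot v u.
Proof. by apply: eq_bigr => j _; rewrite mulrC. Qed.

Lemma dotDl u v w : dot (u + v) w = dot u w + dot v w.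
Proof. by rewrite -big_split; apply: eq_bigr => j _; rewrite mxE mulrDl. Qed.

Lemma dotZl a u w : dot (a *: u) w = a * dot u w.
Proof. by rewrite mulr_sumr; apply: eq_bigr => j _; rewrite mxE mulrA. Qed.

Lemma dotNl u w : dot (- u) w = - dot u w.
Proof. by rewrite -scaleN1r dotZl mulN1r. Qed.

Lemma dotDr u v w : dot w (u + v) = dot w u + dot w v.
Proof. by rewrite dotC dotDl !(dotC w). Qed.

Lemma dotZr a u w : dot w (a *: u) = a * dot w u.
Proof. by rewrite dotC dotZl dotC. Qed.

Lemma dotNr u w : dot w (- u) = - dot w u.
Proof. by rewrite dotC dotNl dotC. Qed.

Lemma dot0l w : dot 0 w = 0.
Proof. by rewrite /dot big1// => j _; rewrite mxE mul0r. Qed.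

Definition dotE := (dotDl, dotDr, dotNl, dotNr, dotZl, dotZr).

Lemma enorm_sqrZ a x : enorm (a *: x) ^+ 2 = a ^+ 2 * enorm x ^+ 2.
Proof. by rewrite !enorm_sqr dotZl dotZr mulrA expr2. Qed.

(** Young's inequality; with a free weight [c] it plays the part that
    Cauchy-Schwarz usually has in the descent lemma. *)
Lemma dot_young c u v : 0 < c ->
  dot u v <= (enorm u ^+ 2 / c + c * enorm v ^+ 2) / 2.
Proof.
move=> c0; have : 0 <= enorm (u - c *: v) ^+ 2 by rewrite sqr_ge0.
rewrite !enorm_sqr !dotE (dotC v u) => h.
have -> : (dot u u / c + c * dot v v) / 2
   = dot u v + (dot u u - c * dot u v
                + - (c * dot u v - c * (c * dot v v))) / (2 * c).
  by field; rewrite gt_eqF.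
rewrite lerDl divr_ge0 ?mulr_ge0 ?(ltW c0)//.
by apply: (le_trans h); rewrite le_eqVlt; apply/orP; left; apply/eqP; ring.
Qed.

End Euclid.

(** * Gradients, strong convexity and smoothness *)

Section Gradient.
Context {R : realType} {d : nat}.
Implicit Types (g : 'rV[R]_d -> R) (x y v : 'rV[R]_d).

Lemma derive_dot g x v : differentiable g x -> 'D_v g x = dot (grad g x) v.
Proof.
move=> dg; rewrite deriveE// {1}(row_sum_delta v) linear_sum.
by apply: eq_bigr => j _; rewrite linearZ /= /grad mxE deriveE// mulrC.
Qed.

Lemma is_derive_line g x v (t : R) : (forall z, differentiable g z) ->
  is_derive t 1 (fun s : R => g (x + s *: v)) (dot (grad g (x + t *: v)) v).
Proof.
move=> dg; have dv : derivable g (x + t *: v) v by exact: diff_derivable.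
have E : (fun h : R =>
      h^-1 *: (((fun s : R => g (x + s *: v)) \o shift t) (h *: 1)
                - g (x + t *: v))) =
    (fun h => h^-1 *: ((g \o shift (x + t *: v)) (h *: v) - g (x + t *: v))).
  apply/funext => h /=; congr (_ *: (g _ - _)).
  by rewrite [h *: 1]mulr1 scalerDl addrCA.
by split; [rewrite /derivable E|rewrite -derive_dot// /derive E].
Qed.

(** The first-order form of strong convexity: divide the defining inequality
    along the segment from [x] to [y] by the parameter and let it tend to 0
    from the right.  For [mu = 0] this is the gradient inequality of a convex
    function. *)
Lemma strongly_convex_first_order mu g x y :
  strongly_convex mu g -> differentiable g x ->
  g x + dot (grad g x) (y - x) + mu / 2 * enorm (y - x) ^+ 2 <= g y.
Proof.
move=> scg dg; have dv : derivable g x (y - x) by exact: diff_derivable.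
set q := enorm (y - x) ^+ 2.
(* The difference quotient minus the part of the quadratic term that is
   linear in [h]: it is bounded by a constant on ]0, 1]. *)
pose F (h : R) := h^-1 * (g (h *: (y - x) + x) - g x) - mu / 2 * q * h.
have cF : F h @[h --> 0^'+] --> dot (grad g x) (y - x) - mu / 2 * q * 0.
  apply: cvg_dnbhs_at_right; apply: cvgB; first by rewrite -derive_dot.
  by apply: cvgM; [exact: cvg_cst|exact: nbhs_dnbhs].
suff : lim (F h @[h --> 0^'+]) <= g y - g x - mu / 2 * q.
  by rewrite (cvg_lim _ cF)//; lra.
apply: limr_le; first by apply/cvg_ex; eexists; exact: cF.
near=> h.
have h0 : 0 < h by near: h; exact: nbhs_right_gt.
have h1 : h <= 1 by near: h; exact: nbhs_right_le.
have := scg y x h; rewrite (ltW h0) h1 => /(_ isT).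
have -> : h *: y + (1 - h) *: x = h *: (y - x) + x.
  by rewrite scalerBl scalerBr scale1r addrA addrAC.
rewrite -/q => le.
rewrite /F -subr_ge0.
have -> : g y - g x - mu / 2 * q
   - (h^-1 * (g (h *: (y - x) + x) - g x) - mu / 2 * q * h) =
   (h * g y + (1 - h) * g x - mu / 2 * (h * (1 - h)) * q
     - g (h *: (y - x) + x)) / h.
  by field; rewrite gt_eqF.
by rewrite divr_ge0 ?subr_ge0// ltW.
Unshelve. all: by end_near. Qed.

Lemma convex_strongly_convex0 g : convex_function setT g -> strongly_convex 0 g.
Proof.
move=> cg x y t /andP[t0 t1].
have := cg (Itv01 t0 t1) x y; rewrite !inE => /(_ I I).
by rewrite mul0r mul0r mul0r subr0.
Qed.

Lemma smooth_le L M g : L <= M -> smooth L g -> smooth M g.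
Proof.
move=> LM [dg lg]; split=> // x y; apply: le_trans (lg x y) _.
by rewrite ler_wpM2r// enorm_ge0.
Qed.

(** The quadratic upper bound of a smooth function. *)
Lemma descent L g x v : 0 < L -> smooth L g ->
  g (x + v) <= g x + dot (grad g x) v + L / 2 * enorm v ^+ 2.
Proof.
move=> L0 [dg lg].
(* [p] has a nonpositive derivative on [0, 1], and [p 1 <= p 0] is the claim. *)
pose p (t : R) := g (x + t *: v) - (t * dot (grad g x) v
   + L / 2 * enorm v ^+ 2 * t ^+ 2).
have dp (t : R) : is_derive t 1 p (dot (grad g (x + t *: v)) v
   - (dot (grad g x) v + L * enorm v ^+ 2 * t)).
  have := is_derive_line x v t dg => ?.
  apply: is_derive_eq.
  rewrite /GRing.scale/= mulr0 add0r !mulr1.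
  by congr (_ - (_ + _)); field.
have : p 1 <= p 0.
  apply: (@ler0_derive1_le_cc _ p 0 1) => //.
  - move=> t; rewrite in_itv/= => /andP[t0 _].
    rewrite derive1E derive_val opprD addrA -dotNl -dotDl.
    have Lt0 : 0 < L * t by rewrite mulr_gt0.
    (* The weight [L * t] makes both terms of Young's bound at most
       [L * t * enorm v ^+ 2]. *)
    have := dot_young (grad g (x + t *: v) - grad g x) v Lt0.
    have := lg (x + t *: v) x; rewrite [in X in _ <= X -> _]addrC addKr.
    set a := grad g _ - grad g x => h1 h2.
    rewrite subr_le0; apply: le_trans h2 _.
    have h3 : enorm a ^+ 2
        <= L ^+ 2 * (t ^+ 2 * enorm v ^+ 2).
      rewrite -enorm_sqrZ -exprMn; apply: lerXn2r h1;
        rewrite nnegrE ?enorm_ge0//.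
      by apply: mulr_ge0; [exact: ltW|exact: enorm_ge0].
    rewrite ler_pdivrMr//.
    suff : enorm a ^+ 2 / (L * t)
        <= L * t * enorm v ^+ 2 by lra.
    rewrite ler_pdivrMr//; apply: le_trans h3 _.
    by rewrite le_eqVlt; apply/orP; left; apply/eqP; ring.
  - by apply: derivable_within_continuous.
  - by rewrite in_itv/= lexx ler01.
  - by rewrite in_itv/= lexx ler01.
rewrite /p scale1r scale0r addr0; lra.
Qed.

(** A gradient step of length [L^-1] decreases [g] by at least
    [enorm (grad g x) ^+ 2 / (2 * L)], but not below the infimum. *)
Lemma smooth_inf_value L g x : 0 < L -> smooth L g -> has_lbound (range g) ->
  enorm (grad g x) ^+ 2 <= 2 * L * (g x - inf_value g).
Proof.
move=> L0 sg lbg.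
have := descent x (- L^-1 *: grad g x) L0 sg.
rewrite dotZr -enorm_sqr enorm_sqrZ.
set y := (X in g X) => le1.
have : inf_value g <= g y by apply: ge_inf => //; exists y.
move=> /le_trans/(_ le1).
set G := enorm _ ^+ 2.
have -> : g x + - L^-1 * G + L / 2 * ((- L^-1) ^+ 2 * G) = g x - G / (2 * L).
  by field; rewrite gt_eqF.
move=> h; have : G / (2 * L) <= g x - inf_value g by lra.
by rewrite ler_pdivrMr ?mulr_gt0// mulrC.
Qed.

Lemma grad_at_inf_value L g x : smooth L g -> has_lbound (range g) ->
  g x = inf_value g -> grad g x = 0.
Proof.
move=> sg lbg gx.
(* [L] may be nonpositive, so it is first replaced by a positive constant. *)
have M0 : 0 < Num.max L 1 by rewrite lt_max ltr01 orbT.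
have LM : L <= Num.max L 1 by rewrite le_max lexx.
have := smooth_inf_value x M0 (smooth_le LM sg) lbg.
rewrite gx subrr mulr0 => h; apply/eqP; rewrite -enorm_eq0.
by rewrite -sqrf_eq0 eq_le h sqr_ge0.
Qed.

End Gradient.

(** * Finite averages *)

Section FiniteAverage.
Context {R : realType} {d n : nat}.
Implicit Types (f : 'I_n -> 'rV[R]_d -> R) (x v xs : 'rV[R]_d).

Lemma finite_avgE f : finite_avg f = n%:R^-1 \*: (\sum_(i < n) f i).
Proof. by apply/funext => x; rewrite /finite_avg /= fct_sumE. Qed.

Lemma differentiable_finite_avg f x :
  (forall i, differentiable (f i) x) -> differentiable (finite_avg f) x.
Proof.
move=> df; rewrite finite_avgE.
by apply: differentiableZ; exact: differentiable_sum.
Qed.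

Lemma dot_grad_finite_avg f x v : (forall i, differentiable (f i) x) ->
  dot (grad (finite_avg f) x) v = n%:R^-1 * \sum_(i < n) dot (grad (f i) x) v.
Proof.
move=> df; rewrite -derive_dot; last exact: differentiable_finite_avg.
have dfv i : derivable (f i) x v by exact: diff_derivable.
rewrite finite_avgE deriveZ; last exact/diff_derivable/differentiable_sum.
rewrite derive_sum//; congr (_ * _).
by apply: eq_bigr => i _; rewrite derive_dot.
Qed.

(** Interpolation: the terms of [sigma2] are nonnegative, so they all vanish. *)
Lemma sigma2_eq0 f xs : (0 < n)%N -> (forall i, has_lbound (range (f i))) ->
  sigma2 f xs = 0 -> forall i, f i xs = inf_value (f i).
Proof.
move=> n0 lbf /eqP; rewrite /sigma2 mulf_eq0 invr_eq0 pnatr_eq0 gtn_eqF//=.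
rewrite psumr_eq0 => [/allP/= h i|i _].
  by apply/eqP; rewrite -subr_eq0; apply: h; rewrite mem_index_enum.
by rewrite subr_ge0; apply: ge_inf => //; exists xs.
Qed.

End FiniteAverage.

(** * One step of the method *)

Section Step.
Context {R : realType} {d : nat}.
Implicit Types (g : 'rV[R]_d -> R) (x xs : 'rV[R]_d).

(** The added term is [2 / M] times the Bregman gap of [g] between [xs] and
    [x].  When the gradient vanishes the point does not move and this gap is
    nonpositive. *)
Lemma sps_step_dist M g x xs : 0 < M -> smooth M g ->
  convex_function setT g -> has_lbound (range g) -> g xs = inf_value g ->
  enorm (sps_step 2^-1 g x - xs) ^+ 2
    + 2 / M * (g xs - g x - dot (grad g x) (xs - x)) <= enorm (x - xs) ^+ 2.
Proof.
move=> M0 sg cg lbg gxs; rewrite /sps_step; case: ifPn => [/eqP g0|g0].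
  rewrite g0 dot0l subr0 gerDl mulr_ge0_le0//; first by rewrite divr_ge0// ltW.
  by rewrite subr_le0 gxs; apply: ge_inf => //; exists x.
have := strongly_convex_first_order xs (convex_strongly_convex0 cg) (sg.1 x).
have := smooth_inf_value x M0 sg lbg.
have G0 : 0 < enorm (grad g x) ^+ 2 by rewrite exprn_gt0// enorm_gt0.
rewrite /sps_stepsize -gxs mul0r mul0r addr0.
have -> : xs - x = - (x - xs) by rewrite opprB.
rewrite [x - _ - xs]addrAC.
move: (x - xs) => y; rewrite dotNr !enorm_sqr !dotE (dotC y).
rewrite enorm_sqr in G0; move: (grad g x) G0 => u.
move: (dot u u) (dot u y) (dot y y) => G s q G0 h1 h2.
set D := g xs - g x - - s.
have D0 : 0 <= D by rewrite /D; lra.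
set gam := (g x - g xs) / _.
have gamM : 1 / M <= gam.
  rewrite /gam ler_pdivlMr ?mulr_gt0 ?invr_gt0//.
  have -> : 1 / M * (2^-1 * G) = G / (2 * M) by field; rewrite gt_eqF.
  by rewrite ler_pdivrMr ?mulr_gt0// mulrC.
have -> : q - gam * s - gam * (s - gam * G) = q - 2 * (gam * D).
  by rewrite /D /gam; field; rewrite gt_eqF.
have : 1 / M * D <= gam * D by rewrite ler_wpM2r.
lra.
Qed.

Lemma sps_step_fixed c g x : grad g x = 0 -> sps_step c g x = x.
Proof. by rewrite /sps_step => ->; rewrite eqxx. Qed.

Variable n : nat.
Implicit Types f : 'I_n -> 'rV[R]_d -> R.

(** The mean squared distance to the common minimizer contracts by the factor
    [1 - mu / M] in one step. *)
Lemma avg_sps_step_dist mu M f x xs : (0 < n)%N -> 0 < M ->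
  (forall i, smooth M (f i)) -> (forall i, convex_function setT (f i)) ->
  (forall i, has_lbound (range (f i))) ->
  (forall i, f i xs = inf_value (f i)) ->
  strongly_convex mu (finite_avg f) ->
  n%:R^-1 * \sum_(i < n) enorm (sps_step 2^-1 (f i) x - xs) ^+ 2
    <= (1 - mu / M) * enorm (x - xs) ^+ 2.
Proof.
move=> n0 M0 sf cf lbf fxs scf.
have df i : differentiable (f i) x by exact: (sf i).1.
have nR0 : 0 < n%:R^-1 :> R by rewrite invr_gt0 ltr0n.
have := strongly_convex_first_order xs scf (differentiable_finite_avg df).
rewrite dot_grad_finite_avg// /finite_avg enormC.
have : n%:R^-1 * \sum_(i < n) (enorm (sps_step 2^-1 (f i) x - xs) ^+ 2
      + 2 / M * (f i xs - f i x - dot (grad (f i) x) (xs - x)))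
    <= n%:R^-1 * \sum_(i < n) enorm (x - xs) ^+ 2.
  rewrite ler_pM2l//; apply: ler_sum => i _; exact: sps_step_dist.
rewrite sumr_const card_ord -(mulr_natl (enorm _ ^+ 2)).
rewrite mulKf ?pnatr_eq0 -?lt0n//.
rewrite big_split/= -mulr_sumr !sumrB.
move: (\sum_(i < n) enorm _ ^+ 2) (\sum_(i < n) f i xs) (\sum_(i < n) f i x)
  (\sum_(i < n) dot _ _) (n%:R^-1) (enorm _ ^+ 2) => S a b e c q.
rewrite -subr_ge0 => h1; rewrite -subr_ge0 => h2; rewrite -subr_ge0.
(* [h1] is the averaged one-step bound, [h2] strong convexity: the claim is
   [h1] plus [2 / M] times [h2]. *)
have iM : 0 < 2 / M by rewrite divr_gt0.
have := mulr_ge0 (ltW iM) h2.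
move=> h3; apply: le_trans (addr_ge0 h1 h3) _.
by rewrite le_eqVlt; apply/orP; left; apply/eqP; field; rewrite gt_eqF.
Qed.

End Step.

(** * Trajectories along a word of indices *)

Lemma big_tuple_cons (V : nmodType) (J : finType) k (F : k.+1.-tuple J -> V) :
  \sum_t F t = \sum_i \sum_(t : k.-tuple J) F (cons_tuple i t).
Proof.
rewrite pair_big /= (reindex (fun p : J * k.-tuple J => cons_tuple p.1 p.2))//=.
exists (fun t => (thead t, behead_tuple t)) => [[i t] _|t _] /=.
  by congr (_, _); apply: val_inj.
by rewrite [RHS]tuple_eta; apply: val_inj.
Qed.

Section Trajectories.
Context {R : realType} {d n : nat}.
Implicit Types (f : 'I_n -> 'rV[R]_d -> R) (idx : nat -> 'I_n).

Lemma sgd_sps_shift c f x idx k :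
  sgd_sps c f x idx k.+1 =
    sgd_sps c f (sps_step c (f (idx 0%N)) x) (fun j => idx j.+1) k.
Proof.
by elim: k => [//|k IH]; rewrite [LHS]/= -/(sgd_sps c f x idx k.+1) IH.
Qed.

Lemma eq_sgd_sps c f x idx idx' k : (forall j, (j < k)%N -> idx j = idx' j) ->
  sgd_sps c f x idx k = sgd_sps c f x idx' k.
Proof.
elim: k => [//|k IH] e /=; rewrite (e k (ltnSn k)); congr sps_step.
by apply: IH => j jk; apply: e; exact: ltnW.
Qed.

Lemma sgd_sps_fixed c f x idx k : (forall i, grad (f i) x = 0) ->
  sgd_sps c f x idx k = x.
Proof. by move=> fx; elim: k => [//|k IH] /=; rewrite IH sps_step_fixed. Qed.

End Trajectories.

(** If the mean of [Q] after one step is at most [r] times [Q], then the mean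
    of [Q] over all words of length [k] is at most [r ^+ k] times [Q]; the
    induction removes the first letter of the word and changes the starting
    point accordingly.  The default value [ord0] of [nth] is never read. *)
Lemma sgd_sps_mean_contract (R : realType) (d n : nat)
    (f : 'I_n.+1 -> 'rV[R]_d -> R) (Q : 'rV[R]_d -> R) c r x k :
  0 <= r ->
  (forall y, n.+1%:R^-1 * \sum_i Q (sps_step c (f i) y) <= r * Q y) ->
  \sum_(t : k.-tuple 'I_n.+1) n.+1%:R^-1 ^+ k * Q (sgd_sps c f x (nth ord0 t) k)
    <= r ^+ k * Q x.
Proof.
move=> r0 Qr; elim: k x => [|k IH] x.
  rewrite (big_pred1 [tuple]) => [|t]; first by rewrite !expr0.
  by apply/esym/eqP; exact: tuple0.
rewrite big_tuple_cons.
under eq_bigr => i _.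
  under eq_bigr => t _ do rewrite sgd_sps_shift exprS -mulrA /=.
  rewrite -mulr_sumr; over.
rewrite -mulr_sumr.
apply: (@le_trans _ _ (n.+1%:R^-1 * \sum_i r ^+ k * Q (sps_step c (f i) x))).
  by rewrite ler_wpM2l ?invr_ge0//; apply: ler_sum => i _; exact: IH.
rewrite -mulr_sumr mulrCA exprSr -mulrA ler_wpM2l// exprn_ge0//.
Qed.

(** * Expectation of a function of the first indices *)

Section IidWords.
Context {disp : measure_display} {T : measurableType disp} {R : realType}.
Context {P : probability T R} {n : nat} {I : nat -> T -> 'I_n.+1}.

(** The first [k] indices are uniform over the words of length [k]: the event
    that they spell a given word has probability [n.+1%:R^-1 ^+ k]. *)
Lemma expectation_iid_uniform (k : nat) (h : k.-tuple 'I_n.+1 -> R) :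
  iid_uniform P I -> (forall t, 0 <= h t) ->
  ('E_P[fun w => h [tuple I i w | i < k]] =
    (\sum_t n.+1%:R^-1 ^+ k * h t)%R%:E)%E.
Proof.
move=> [mI PI indI] h0.
(* [A t] is the event that the first [k] indices spell [t]. *)
pose A (t : k.-tuple 'I_n.+1) :=
  \bigcap_(j in [set` iota 0 k]) I j @^-1` [set nth ord0 t j].
have AE t w : A t w <-> t = [tuple I i w | i < k].
  split=> [Atw|-> j /=].
    apply: eq_from_tnth => i; rewrite tnth_mktuple (tnth_nth ord0).
    by rewrite -(Atw i)//= mem_iota ltn_ord.
  rewrite mem_iota/= add0n => jk.
  exact/esym/(nth_mktuple _ _ (Ordinal jk)).
have mA t : measurable (A t).
  by apply: fin_bigcap_measurable => [|j _]; [exact: finite_seq|exact: mI].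
have PA t : P (A t) = (n.+1%:R^-1 ^+ k)%:E.
  rewrite /A (indI _ (fun j => [set nth ord0 t j])) ?iota_uniq//.
  under eq_bigr => j _ do rewrite PI.
  by rewrite prodEFin big_const_seq count_predT size_iota iter_mulr_1.
rewrite unlock.
transitivity (\int[P]_w \sum_t (h t)%:E * (\1_(A t) w)%:E)%E.
  apply: eq_integral => w _.
  rewrite (bigD1 [tuple I i w | i < k])//= big1 ?adde0 => [|t tw].
    by rewrite indicE mem_set ?mule1//; exact/AE.
  rewrite indicE memNset ?mule0// => /AE tE.
  by rewrite tE eqxx in tw.
rewrite ge0_integral_sum//; last 2 first.
- by move=> t; apply: measurable_funeM; apply/measurable_EFinP/measurable_indic.
- by move=> t w _; rewrite mule_ge0 ?lee_fin.
rewrite -sumEFin; apply: eq_bigr => t _.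
rewrite ge0_integralZl_EFin//; last exact/measurable_EFinP/measurable_indic.
by rewrite integral_indic// setIT mulrC EFinM; congr (_ * _)%E; exact: PA.
Qed.

End IidWords.

(** * Linear convergence *)

Theorem corollary3p2 (R : realType) (d n : nat)
    (f : 'I_n.+1 -> 'rV[R]_d -> R) (L : 'I_n.+1 -> R) (mu : R)
    (xs x0 : 'rV[R]_d)
    (disp : measure_display) (T : measurableType disp) (P : probability T R)
    (I : nat -> T -> 'I_n.+1)
    (f_convex : forall i, convex_function setT (f i))
    (f_smooth : forall i, smooth (L i) (f i))
    (f_bounded_below : forall i, has_lbound (range (f i)))
    (mu_gt0 : 0 < mu)
    (f_strongly_convex : strongly_convex mu (finite_avg f))
    (xs_min : minimizer (finite_avg f) xs)
    (interpolation : sigma2 f xs = 0)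
    (I_iid : iid_uniform P I)
    (k : nat) :
  let Lmax := \big[Num.max/L ord0]_(i < n.+1) L i in
  ('E_P[fun w => (enorm (sgd_sps (2^-1) f x0 (fun j => I j w) k - xs) ^+ 2)%R]
    <= ((1 - mu / Lmax) ^+ k * enorm (x0 - xs) ^+ 2)%:E)%E.
Proof.
cbv zeta; set Lmax := \big[_/_]_(_ < _) _.
have fxs := sigma2_eq0 (ltn0Sn n) f_bounded_below interpolation.
have gxs i : grad (f i) xs = 0.
  exact: grad_at_inf_value (f_smooth i) (f_bounded_below i) (fxs i).
have smf i : smooth Lmax (f i).
  by apply: smooth_le (f_smooth i); exact: le_bigmax.
pose Q (y : 'rV[R]_d) := enorm (y - xs) ^+ 2.
pose h (t : k.-tuple 'I_n.+1) := Q (sgd_sps 2^-1 f x0 (nth ord0 t) k).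
have -> : (fun w => enorm (sgd_sps 2^-1 f x0 (fun j => I j w) k - xs) ^+ 2)
  = (fun w => h [tuple I i w | i < k]).
  apply/funext => w; congr (enorm (_ - xs) ^+ 2); apply: eq_sgd_sps => j jk.
  exact/esym/(nth_mktuple _ _ (Ordinal jk)).
have h_ge0 t : 0 <= h t by exact: sqr_ge0.
rewrite (expectation_iid_uniform I_iid h_ge0) lee_fin.
have [x0xs|x0xs] := eqVneq x0 xs.
  rewrite x0xs subrr enorm0 expr0n mulr0 big1// => t _.
  by rewrite /h x0xs sgd_sps_fixed// /Q subrr enorm0 expr0n mulr0.
have Q0 : 0 < Q x0 by rewrite exprn_gt0// enorm_gt0 subr_eq0.
(* Otherwise all gradients vanish at [x0], as they do at [xs], and strong
   convexity would make [x0] strictly better than the minimizer [xs]. *)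
have Lmax0 : 0 < Lmax.
  rewrite ltNge; apply/negP => Lmax_le0.
  have gx0 i : grad (f i) x0 = 0.
    apply/eqP; rewrite -enorm_eq0 eq_le enorm_ge0 andbT.
    have := (smf i).2 x0 xs; rewrite gxs subr0 => /le_trans; apply.
    by rewrite mulr_le0_ge0// enorm_ge0.
  have df i : differentiable (f i) x0 by exact: (smf i).1.
  have := strongly_convex_first_order xs f_strongly_convex
    (differentiable_finite_avg df).
  rewrite dot_grad_finite_avg// big1 => [|i _]; last by rewrite gx0 dot0l.
  rewrite mulr0 addr0 enormC => /le_trans/(_ (xs_min x0)).
  by rewrite gerDl leNgt mulr_gt0// divr_gt0.
have step y : n.+1%:R^-1 * \sum_i Q (sps_step 2^-1 (f i) y)
    <= (1 - mu / Lmax) * Q y by exact: avg_sps_step_dist.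
apply: sgd_sps_mean_contract => //.
(* The factor is nonnegative because its product with [Q x0 > 0] bounds a
   mean of squares from above. *)
rewrite -(pmulr_lge0 _ Q0); apply: le_trans (step x0).
by rewrite mulr_ge0 ?invr_ge0// sumr_ge0// => i _; exact: sqr_ge0.
Qed.
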